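(* Let $f,g:X\to\mathbb{R}$ be two $G$-invariant functions on a $G$-space $X$. Let $\mathcal{X}_f$ and $\mathcal{X}_g$ denote the corresponding persistence $G$-spaces defined by sublevel sets. Then $$d_I\big(H_G^\ast(\mathcal{X}_f),H_G^\ast(\mathcal{X}_g)\big)\leq\|f-g\|_\infty.$$ Specifically, if $\|f-g\|_\infty\leq\varepsilon$, then the persistence modules $H_G^\ast(\mathcal{X}_f)$ and $H_G^\ast(\mathcal{X}_g)$ are $\varepsilon$-interleaved.
   Context: $G$ is a Hausdorff topological group and $\mathbb{K}$ a fixed coefficient field. For a left $G$-space $Y$, $H_G^\ast(Y)=H^\ast(EG\times_GY;\mathbb{K})$ is its Borel equivariant cohomology, a graded module over $\mathcal{H}_G^\ast=H^\ast(BG;\mathbb{K})$, contravariantly functorial for $G$-equivariant continuous maps. A function $f:X\to\mathbb{R}$ is $G$-invariant if $f(g\cdot x)=f(x)$ for all $g\in G$, $x\in X$. $\mathcal{X}_f$ is the functor from $(\mathbb{R},\leq)$ to $G$-spaces with $\mathcal{X}_f(t)=f^{-1}((-\infty,t])$ and inclusions as structure maps. $H_G^\ast(\mathcal{X}_f)$ is the contravariant functor $t\mapsto H_G^\ast(\mathcal{X}_f(t))$ from $(\mathbb{R},\leq)$ to graded $\mathcal{H}_G^\ast$-modules, with structure maps the pullbacks along inclusions. Two such contravariant persistence modules $\mathcal{A},\mathcal{B}$ are $\varepsilon$-interleaved if there are families of graded $\mathcal{H}_G^\ast$-module maps $\mathcal{B}(t+\varepsilon)\to\mathcal{A}(t)$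 and $\mathcal{A}(t+\varepsilon)\to\mathcal{B}(t)$, natural in $t$, whose composites are the structure maps $\mathcal{A}(t+2\varepsilon)\to\mathcal{A}(t)$ and $\mathcal{B}(t+2\varepsilon)\to\mathcal{B}(t)$. $d_I(\mathcal{A},\mathcal{B})$ is the infimum of all $\varepsilon\geq0$ for which $\mathcal{A},\mathcal{B}$ are $\varepsilon$-interleaved. $\|f-g\|_\infty=\sup_{x\in X}|f(x)-g(x)|$. *)

(* Defs.v *)
From HB Require Import structures.
From mathcomp Require Import all_boot all_order all_algebra.
From mathcomp Require Import all_classical all_reals all_analysis.
From mathcomp Require Import ring_quotient generic_quotient zify ring.

Set Implicit Arguments.
Unset Strict Implicit.
Unset Printing Implicit Defensive.

Import Order.TTheory GRing.Theory Num.Theory.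
Import numFieldNormedType.Exports.

Local Open Scope classical_set_scope.
Local Open Scope ring_scope.
Local Open Scope quotient_scope.

HB.mixin Record isTopologicalGroup G of Topological G & Group G := {
  mulg_continuous : continuous (fun p : G * G => (p.1 * p.2)%g);
  invg_continuous : continuous (fun g : G => g^-1%g)
}.

#[short(type="topologicalGroupType")]
HB.structure Definition TopologicalGroup :=
  {G of Topological G & Group G & isTopologicalGroup G}.

Record gSpace (G : topologicalGroupType) := GSpace {
  gspace_sort :> topologicalType;
  lact : G -> gspace_sort -> gspace_sort;
  lact1 : forall x, lact 1%g x = x;
  lactM : forall g h x, lact (g * h)%g x = lact g (lact h x);
  lact_continuous : continuous (fun p : G * gspace_sort => lact p.1 p.2)
}.

Record rightGSpace (G : topologicalGroupType) := RightGSpace {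
  rspace_sort :> topologicalType;
  ract : rspace_sort -> G -> rspace_sort;
  ract1 : forall x, ract x 1%g = x;
  ractM : forall x g h, ract x (g * h)%g = ract (ract x g) h;
  ract_continuous : continuous (fun p : rspace_sort * G => ract p.1 p.2)
}.

Record gMap (G : topologicalGroupType) (X Y : gSpace G) := GMap {
  gmap_fun :> X -> Y;
  gmap_continuous : continuous gmap_fun;
  gmapE : forall g x, gmap_fun (lact g x) = lact g (gmap_fun x)
}.

(* Quotients of vector spaces: the library only provides the underlying
   additive group. *)
Section LmodQuotient.
Variables (K : fieldType) (V : lmodType K) (I : zmodClosed V).
Variable I_scale : scaler_closed I.

Definition lmod_quot : Type := let _ := I_scale in (Quotient.quot I).

HB.instance Definition _ := GRing.Zmodule.copy lmod_quot (Quotient.quot I).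

Definition lmodq_pi (x : V) : lmod_quot := \pi_((Quotient.quot I)) x.

Lemma lmodq_eqP (x y : V) : reflect (lmodq_pi x = lmodq_pi y) (x - y \in I).
Proof. by rewrite Quotient.idealrBE; apply: eqP. Qed.

Lemma lmodq_ind (P : lmod_quot -> Prop) :
  (forall v, P (lmodq_pi v)) -> forall x, P x.
Proof. by move=> h x; rewrite -[x](@reprK _ (Quotient.quot I)). Qed.

Lemma lmodq_reprE (x : lmod_quot) : lmodq_pi (repr (x : (Quotient.quot I))) = x.
Proof. exact: reprK. Qed.

Lemma lmodq_piD x y : lmodq_pi (x + y) = lmodq_pi x + lmodq_pi y.
Proof. exact: (raddfD \pi_((Quotient.quot I))). Qed.

Definition lmodq_scale (a : K) (x : lmod_quot) : lmod_quot :=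
  lmodq_pi (a *: repr (x : (Quotient.quot I))).

Lemma lmodq_scale_pi a x : lmodq_scale a (lmodq_pi x) = lmodq_pi (a *: x).
Proof.
apply/lmodq_eqP; rewrite -scalerBr I_scale //.
by apply/lmodq_eqP; rewrite lmodq_reprE.
Qed.

Fact lmodq_scaleA a b v :
  lmodq_scale a (lmodq_scale b v) = lmodq_scale (a * b) v.
Proof. by elim/lmodq_ind: v => v; rewrite !lmodq_scale_pi scalerA. Qed.

Fact lmodq_scale1 : left_id 1 lmodq_scale.
Proof. by elim/lmodq_ind => v; rewrite lmodq_scale_pi scale1r. Qed.

Fact lmodq_scaleDr : right_distributive lmodq_scale +%R.
Proof.
move=> a; elim/lmodq_ind => u; elim/lmodq_ind => v.
by rewrite -lmodq_piD !lmodq_scale_pi scalerDr lmodq_piD.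
Qed.

Fact lmodq_scaleDl v : {morph lmodq_scale^~ v : a b / a + b}.
Proof.
move=> a b; elim/lmodq_ind: v => v.
by rewrite !lmodq_scale_pi scalerDl lmodq_piD.
Qed.

HB.instance Definition _ := GRing.Zmodule_isLmodule.Build K lmod_quot
  lmodq_scaleA lmodq_scale1 lmodq_scaleDr lmodq_scaleDl.

Lemma lmodq_piZ a x : lmodq_pi (a *: x) = a *: lmodq_pi x.
Proof. by rewrite -lmodq_scale_pi. Qed.

End LmodQuotient.

Section Simplex.
Variable R : realType.

Definition simplex (n : nat) : set 'rV[R]_n.+1 :=
  [set v | (forall i, 0 <= v ord0 i) /\ \sum_i v ord0 i = 1].
Arguments simplex : clear implicits.

(* The affine map sending the i-th vertex to the (theta i)-th one. *)
Definition vertex_lin m n (theta : 'I_m.+1 -> 'I_n.+1) (v : 'rV[R]_m.+1) :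
    'rV[R]_n.+1 := \row_j \sum_(i | theta i == j) v ord0 i.

Lemma vertex_lin_simplex m n (theta : 'I_m.+1 -> 'I_n.+1) v :
  v \in simplex m -> vertex_lin theta v \in simplex n.
Proof.
rewrite !inE => -[v0 v1]; split=> [j|].
  by rewrite mxE sumr_ge0.
under eq_bigr do rewrite mxE.
by rewrite -v1 [RHS](partition_big theta predT).
Qed.

Definition vertex_map m n (theta : 'I_m.+1 -> 'I_n.+1) (v : simplex m) :
  simplex n := exist _ (vertex_lin theta (val v)) (vertex_lin_simplex theta (valP v)).

Lemma row_continuous (T : topologicalType) n (f : T -> 'rV[R]_n) :
  (forall j, continuous (fun t => f t ord0 j)) -> continuous f.
Proof.
move=> cf t A [P Pf PA].
have : \forall s \near t, forall j : 'I_n, P ord0 j (f s ord0 j).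
  by apply: filter_forall => j; exact: cf (Pf ord0 j).
by apply: filterS => s Ps; apply: PA => i j; rewrite ord1.
Qed.

Lemma into_set_type_continuous (S T : topologicalType) (A : set T) (f : S -> A) :
  continuous (fun s => \val (f s)) -> continuous f.
Proof.
move=> /continuousP cf; apply/continuousP => U [W oW <-].
exact: cf W oW.
Qed.

Lemma vertex_map_continuous m n (theta : 'I_m.+1 -> 'I_n.+1) :
  continuous (vertex_map theta).
Proof.
apply: into_set_type_continuous; apply: row_continuous => j /=.
under eq_fun do rewrite mxE.
move=> v; have FF : Filter (nbhs v) by exact: nbhs_filter.
apply: (@cvg_big R^o _ _ 0 _ add_continuous _ _ _ _ _ FF) => i _.
apply: (@continuous_comp _ _ _ (fun v : simplex m => \val v) (fun w => w ord0 i)).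
  exact: initial_continuous.
exact: coord_continuous.
Qed.

Lemma vertex_map_comp l m n (eta : 'I_m.+1 -> 'I_n.+1)
    (theta : 'I_l.+1 -> 'I_m.+1) v :
  vertex_map eta (vertex_map theta v) = vertex_map (eta \o theta) v.
Proof.
apply: val_inj; apply/rowP => k /=; rewrite !mxE.
under eq_bigr do rewrite mxE.
rewrite [RHS](partition_big theta (fun j => eta j == k)) //=.
apply: eq_bigr => j /eqP jk; apply: eq_bigl => i /=.
by case: eqP => [->|]; rewrite ?jk ?eqxx ?andbF.
Qed.

End Simplex.

Arguments simplex : clear implicits.

Definition degcast (K : fieldType) (A : nat -> lmodType K) m n (e : m = n)
  (x : A m) : A n := ecast i (A i) e x.

Section SingularCohomology.
Variables (R : realType) (K : fieldType).

Definition sing (X : topologicalType) (n : nat) : Type :=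
  continuousType (simplex R n) X.

Definition sing_vertex X m n (theta : 'I_m.+1 -> 'I_n.+1) (s : sing X n) :
  sing X m := (s : continuousType _ _) \o mkcts (@vertex_map_continuous R _ _ theta).

Definition sing_push (X Y : topologicalType) n (f : continuousType X Y)
  (s : sing X n) : sing Y n := f \o (s : continuousType _ _).

Lemma sing_vertex_comp X l m n (eta : 'I_m.+1 -> 'I_n.+1)
    (theta : 'I_l.+1 -> 'I_m.+1) (s : sing X n) :
  sing_vertex theta (sing_vertex eta s) = sing_vertex (eta \o theta) s.
Proof. by apply/continuousEP => v /=; rewrite /mkcts vertex_map_comp. Qed.

Lemma sing_push_vertex (X Y : topologicalType) m n (f : continuousType X Y)
    (theta : 'I_m.+1 -> 'I_n.+1) (s : sing X n) :
  sing_vertex theta (sing_push f s) = sing_push f (sing_vertex theta s).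
Proof. exact/continuousEP. Qed.

Definition cochain (X : topologicalType) (n : nat) : Type := sing X n -> K.

HB.instance Definition _ X n := GRing.Lmodule.copy (cochain X n) (sing X n -> K^o).

Section Space.
Variable X : topologicalType.
Implicit Types n p q : nat.

Definition cobnd n (phi : cochain X n) : cochain X n.+1 :=
  fun s => \sum_(i < n.+2) (-1) ^+ i * phi (sing_vertex (lift i) s).

Lemma cobnd_linear n : linear (@cobnd n).
Proof.
move=> a phi psi; apply/funext => s; rewrite /cobnd /=.
rewrite [RHS](_ : _ = a * cobnd phi s + cobnd psi s) //.
rewrite mulr_sumr -big_split /=; apply: eq_bigr => i _.
by rewrite (_ : (a *: phi + psi) _ = a * phi (sing_vertex (lift i) s) +
  psi (sing_vertex (lift i) s)) // mulrDr mulrCA.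
Qed.

HB.instance Definition _ n :=
  GRing.isLinear.Build K (cochain X n) (cochain X n.+1) *:%R (@cobnd n)
    (@cobnd_linear n).

Lemma cobndK n (phi : cochain X n) : cobnd (cobnd phi) = 0.
Proof.
apply/funext => s; rewrite /cobnd.
under eq_bigr => i _.
  rewrite mulr_sumr.
  under eq_bigr do rewrite sing_vertex_comp mulrA -exprD.
  over.
rewrite pair_big /= (bigID (fun p : 'I_n.+3 * 'I_n.+2 => (p.2 < p.1)%N)) /=.
rewrite (reindex_onto
  (fun p : 'I_n.+3 * 'I_n.+2 =>
     (inord p.2.+1 : 'I_n.+3, inord p.1 : 'I_n.+2))
  (fun p : 'I_n.+3 * 'I_n.+2 =>
     (inord p.2 : 'I_n.+3, inord p.1.-1 : 'I_n.+2))) /=; last first.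
  by move=> [[i hi] [j hj]] /= ji; congr pair; apply: val_inj => /=;
    rewrite ?inordK /= ?inordK //; lia.
rewrite (eq_bigl (fun p : 'I_n.+3 * 'I_n.+2 => ~~ (p.2 < p.1)%N)); last first.
  move=> [[i hi] [j hj]] /=; rewrite -leqNgt; case: (leqP i j) => ij.
    rewrite (@inordK _ j.+1) // (@inordK _ i); last lia.
    rewrite ltnS ij /=; apply/eqP; congr pair; apply: val_inj => /=.
      by rewrite !inordK //; lia.
    by rewrite !inordK //; lia.
  apply/negbTE/negP => /andP[+ /eqP [/(congr1 (@nat_of_ord _)) + _]] /=.
  case: (ltnP i n.+2) => hi2; first by rewrite !inordK //; lia.
  move=> _; move: (inord i : 'I_n.+2) => k.
  by have kn := ltn_ord k; rewrite inordK /=; lia.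
apply/eqP; rewrite addr_eq0 -sumrN; apply/eqP.
apply: eq_bigr => [[[i hi] [j hj]]] /=; rewrite -leqNgt => ij.
rewrite (@inordK _ j.+1) // (@inordK _ i); last lia.
rewrite (_ : sing_vertex _ s = sing_vertex (lift (Ordinal hi) \o lift (Ordinal hj)) s).
  by rewrite addSn exprS mulN1r (addnC j) mulNr.
congr (sing_vertex _ s); apply/funext => k; apply: val_inj => /=.
rewrite /bump !inordK /=; lia.
Qed.

Definition cocycle n : {pred cochain X n} := fun phi => `[< cobnd phi = 0 >].

Lemma cocycleP n (phi : cochain X n) :
  reflect (cobnd phi = 0) (phi \in @cocycle n).
Proof. exact: asboolP. Qed.

Lemma cocycle_closed n : subsemimod_closed (@cocycle n).
Proof.
split; [split=> [|f g /cocycleP f0 /cocycleP g0]|move=> a f /cocycleP f0].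
- by apply/cocycleP; rewrite linear0.
- by apply/cocycleP; rewrite linearD /= f0 g0 addr0.
- by apply/cocycleP; rewrite linearZ /= f0 scaler0.
Qed.

HB.instance Definition _ n :=
  GRing.isSubmodClosed.Build K (cochain X n) (@cocycle n) (@cocycle_closed n).

Record cocycles n := Cocycle {
  cocycle_val :> cochain X n;
  cocycle_valP : cocycle_val \in @cocycle n
}.

HB.instance Definition _ n := [isSub for @cocycle_val n].
HB.instance Definition _ n := [Choice of cocycles n by <:].
HB.instance Definition _ n := [SubChoice_isSubLmodule of cocycles n by <:].

Definition is_coboundary n : cochain X n -> Prop :=
  match n with
  | 0 => fun phi => phi = 0
  | n'.+1 => fun phi => exists psi : cochain X n', phi = cobnd psi
  end.

Lemma is_coboundary0 n : @is_coboundary n 0.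
Proof. by case: n => [|n] //; exists 0; rewrite linear0. Qed.

Lemma is_coboundaryP n a (phi psi : cochain X n) :
  is_coboundary phi -> is_coboundary psi -> is_coboundary (a *: phi + psi).
Proof.
case: n phi psi => [|n] phi psi; first by move=> -> ->; rewrite scaler0 addr0.
by move=> [u ->] [v ->]; exists (a *: u + v); rewrite linearP.
Qed.

Definition coboundaries n : {pred cocycles n} :=
  fun z => `[< is_coboundary (cocycle_val z) >].

Lemma coboundariesP n (z : cocycles n) :
  reflect (is_coboundary z) (z \in @coboundaries n).
Proof. exact: asboolP. Qed.

Lemma coboundaries_zmod n : zmod_closed (@coboundaries n).
Proof.
split=> [|u v /coboundariesP hu /coboundariesP hv]; apply/coboundariesP.
  exact: is_coboundary0.
by rewrite /= addrC -scaleN1r; apply: is_coboundaryP.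
Qed.

HB.instance Definition _ n :=
  GRing.isZmodClosed.Build (cocycles n) (@coboundaries n)
    (@coboundaries_zmod n).

Lemma coboundaries_scale n : scaler_closed (@coboundaries n).
Proof.
move=> a u /coboundariesP hu; apply/coboundariesP.
rewrite -[a *: u]addr0 /=.
by apply: is_coboundaryP => //; apply: is_coboundary0.
Qed.

Definition cohomology n : lmodType K := lmod_quot (@coboundaries_scale n).

Definition coclass n (z : cocycles n) : cohomology n :=
  lmodq_pi (@coboundaries_scale n) z.

Definition corepr n (x : cohomology n) : cocycles n :=
  repr (x : Quotient.quot (@coboundaries n)).

Lemma coreprK n (x : cohomology n) : coclass (corepr x) = x.
Proof. exact: lmodq_reprE. Qed.

Lemma coclass_eqP n (z w : cocycles n) :
  coclass z = coclass w <-> is_coboundary (cocycle_val z - cocycle_val w).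
Proof.
split; first by move/lmodq_eqP => /coboundariesP.
by move=> h; apply/lmodq_eqP/coboundariesP.
Qed.

Lemma coclass_ind n (P : cohomology n -> Prop) :
  (forall z, P (coclass z)) -> forall x, P x.
Proof. exact: lmodq_ind. Qed.

Lemma coclassP n a (z w : cocycles n) :
  coclass (a *: z + w) = a *: coclass z + coclass w.
Proof. by rewrite /coclass lmodq_piD lmodq_piZ. Qed.

Definition front p n : 'I_p.+1 -> 'I_n.+1 := fun i => inord i.
Definition back q n : 'I_q.+1 -> 'I_n.+1 := fun i => inord (n - q + i).

(* Meaningful for n = p + q; leaving n free avoids casts between degrees. *)
Definition cup p q n (phi : cochain X p) (psi : cochain X q) : cochain X n :=
  fun s => phi (sing_vertex (@front p n) s) * psi (sing_vertex (@back q n) s).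
Arguments cup {p q} n phi psi _.

Definition face n (i : nat) : 'I_n.+1 -> 'I_n.+2 := fun k => inord (bump i k).

Lemma cobndE n (phi : cochain X n) s :
  cobnd phi s = \sum_(0 <= i < n.+2) (-1) ^+ i * phi (sing_vertex (@face n i) s).
Proof.
rewrite big_mkord; apply: eq_bigr => i _; congr (_ * phi (sing_vertex _ s)).
by apply/funext => k; apply: val_inj; rewrite /= inordK // -[bump _ _]/(lift i k : nat).
Qed.

Lemma cup_linearl p q n a (phi phi' : cochain X p) (psi : cochain X q) :
  cup n (a *: phi + phi') psi = a *: cup n phi psi + cup n phi' psi.
Proof.
apply/funext => s; rewrite /cup.
set u := sing_vertex _ s; set v := sing_vertex _ s.
rewrite [RHS](_ : _ = a * (phi u * psi v) + phi' u * psi v) //.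
by rewrite mulrA -mulrDl.
Qed.

Lemma cup_linearr p q n a (phi : cochain X p) (psi psi' : cochain X q) :
  cup n phi (a *: psi + psi') = a *: cup n phi psi + cup n phi psi'.
Proof.
apply/funext => s; rewrite /cup.
set u := sing_vertex _ s; set v := sing_vertex _ s.
rewrite [RHS](_ : _ = a * (phi u * psi v) + phi u * psi' v) //.
by rewrite mulrCA -mulrDr.
Qed.

Lemma cupr0 p q n (phi : cochain X p) : cup n phi (0 : cochain X q) = 0.
Proof. by apply/funext => s; rewrite /cup mulr0. Qed.

Lemma cup0r p q n (psi : cochain X q) : cup n (0 : cochain X p) psi = 0.
Proof. by apply/funext => s; rewrite /cup mul0r. Qed.

Lemma cobnd_cup p q n (phi : cochain X p) (psi : cochain X q) :
  (p + q = n)%N ->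
  cobnd (cup n phi psi) =
  cup n.+1 (cobnd phi) psi + (-1) ^+ p *: cup n.+1 phi (cobnd psi).
Proof.
move=> pqn; apply/funext => s.
rewrite [RHS](_ : _ = cup n.+1 (cobnd phi) psi s +
  (-1) ^+ p * cup n.+1 phi (cobnd psi) s) //.
rewrite /cup !cobndE.
rewrite (@big_cat_nat _ _ _ p.+1) /=; [|lia|lia].
rewrite (big_nat_recr p.+1) //= (big_nat_recl q.+1) //=.
under eq_big_nat => i /andP[_ ip].
  rewrite !sing_vertex_comp.
  rewrite (_ : face _ \o back _ = @back q n.+1); last first.
    apply/funext => -[k hk]; apply: val_inj; rewrite /= /face /back /bump.
    rewrite !inordK /=; lia.
  rewrite (_ : face _ \o front _ = @front p.+1 n.+1 \o @face p i); last first.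
    apply/funext => -[k hk]; apply: val_inj; rewrite /= /face /front /bump.
    rewrite !inordK /=; lia.
  over.
have shift (F : nat -> K) : \sum_(p.+1 <= i < n.+2) F i =
    \sum_(0 <= i < q.+1) F (i + p.+1)%N.
  by rewrite -[in LHS](add0n p.+1) big_addn; congr bigop; congr index_iota; lia.
rewrite shift.
under [X in _ + X = _]eq_big_nat => i /andP[_ iq].
  rewrite !sing_vertex_comp.
  rewrite (_ : face _ \o front _ = @front p n.+1); last first.
    apply/funext => -[k hk]; apply: val_inj; rewrite /= /face /front /bump.
    rewrite !inordK /=; lia.
  rewrite (_ : face _ \o back _ = @back q.+1 n.+1 \o @face q i.+1); last first.
    apply/funext => -[k hk]; apply: val_inj; rewrite /= /face /back /bump.
    rewrite !inordK /=; lia.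
  over.
rewrite !sing_vertex_comp.
rewrite (_ : front n.+1 \o face p.+1 = @front p n.+1); last first.
  apply/funext => -[k hk]; apply: val_inj; rewrite /= /face /front /bump.
  rewrite !inordK /=; lia.
rewrite (_ : back n.+1 \o face 0 = @back q n.+1); last first.
  apply/funext => -[k hk]; apply: val_inj; rewrite /= /face /back /bump.
  rewrite !inordK /=; lia.
rewrite mulrDl expr0 mul1r !mulrDr mulr_suml !mulr_sumr -addrA.
congr (_ + _).
  by apply: eq_bigr => i _; rewrite sing_vertex_comp mulrA.
rewrite addrA exprS mulN1r !mulNr mulrA addNr add0r.
apply: eq_bigr => i _; rewrite sing_vertex_comp.
by rewrite addnS -addSn exprD; ring.
Qed.

Lemma cupB p q n (phi phi' : cochain X p) (psi psi' : cochain X q) :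
  cup n phi psi - cup n phi' psi' =
  cup n (phi - phi') psi + cup n phi' (psi - psi').
Proof.
apply/funext => s; pose u := sing_vertex (@front p n) s.
pose v := sing_vertex (@back q n) s.
rewrite [LHS](_ : _ = phi u * psi v - phi' u * psi' v) //.
rewrite [RHS](_ : _ = (phi u - phi' u) * psi v + phi' u * (psi v - psi' v)) //.
ring.
Qed.

Lemma cup_cocycle p q n (z : cocycles p) (w : cocycles q) :
  (p + q = n)%N -> cup n z w \in @cocycle n.
Proof.
move=> pqn; apply/cocycleP; rewrite cobnd_cup //.
by rewrite (cocycleP _ (cocycle_valP z)) (cocycleP _ (cocycle_valP w)) cup0r
  cupr0 scaler0 addr0.
Qed.

Definition cocycle_cup p q (z : cocycles p) (w : cocycles q) :
  cocycles (p + q) := Cocycle (cup_cocycle z w erefl).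

Lemma cup_coboundaryl p q n (phi : cochain X p) (w : cocycles q) :
  (p + q = n)%N -> is_coboundary phi -> is_coboundary (cup n phi w).
Proof.
case: p phi => [|p] phi /=; first by move=> _ ->; rewrite cup0r; exact: is_coboundary0.
case: n => // n [pqn] [psi ->]; exists (cup n psi w).
by rewrite cobnd_cup // (cocycleP _ (cocycle_valP w)) cupr0 scaler0 addr0.
Qed.

Lemma cup_coboundaryr p q n (z : cocycles p) (psi : cochain X q) :
  (p + q = n)%N -> is_coboundary psi -> is_coboundary (cup n z psi).
Proof.
case: q psi => [|q] psi /=; first by move=> _ ->; rewrite cupr0; exact: is_coboundary0.
case: n => [|n] pqn; first by move: pqn; rewrite addnS.
have {}pqn : (p + q = n)%N by lia.
move=> [phi ->]; exists ((-1) ^+ p *: cup n z phi).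
rewrite linearZ /= cobnd_cup // (cocycleP _ (cocycle_valP z)) cup0r add0r.
by rewrite scalerA -expr2 sqrr_sign scale1r.
Qed.

Definition cohom_cup p q (x : cohomology p) (y : cohomology q) :
  cohomology (p + q) := coclass (cocycle_cup (corepr x) (corepr y)).

Lemma cohom_cupE p q (z : cocycles p) (w : cocycles q) :
  cohom_cup (coclass z) (coclass w) = coclass (cocycle_cup z w).
Proof.
have /coclass_eqP hz := coreprK (coclass z).
have /coclass_eqP hw := coreprK (coclass w).
apply/coclass_eqP => /=; set z' := corepr _ in hz *; set w' := corepr _ in hw *.
rewrite cupB -[X in is_coboundary (X + _)]scale1r; apply: is_coboundaryP.
  exact: cup_coboundaryl.
exact: cup_coboundaryr.
Qed.

Lemma cohom_cup_linearl p q a (x x' : cohomology p) (y : cohomology q) :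
  cohom_cup (a *: x + x') y = a *: cohom_cup x y + cohom_cup x' y.
Proof.
elim/coclass_ind: x => x; elim/coclass_ind: x' => x'; elim/coclass_ind: y => y.
rewrite -coclassP !cohom_cupE -coclassP; congr coclass.
by apply: val_inj => /=; rewrite cup_linearl.
Qed.

Lemma cohom_cup_linearr p q a (x : cohomology p) (y y' : cohomology q) :
  cohom_cup x (a *: y + y') = a *: cohom_cup x y + cohom_cup x y'.
Proof.
elim/coclass_ind: x => x; elim/coclass_ind: y' => y'; elim/coclass_ind: y => y.
rewrite -coclassP !cohom_cupE -coclassP; congr coclass.
by apply: val_inj => /=; rewrite cup_linearr.
Qed.

Lemma sing_vertex_id n (theta : 'I_n.+1 -> 'I_n.+1) (s : sing X n) :
  (forall i, theta i = i) -> sing_vertex theta s = s.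
Proof.
move=> h; apply/continuousEP => v /=; congr (s _); apply: val_inj.
apply/rowP => j /=; rewrite !mxE (bigD1 j) /= ?h //.
by rewrite big1 ?addr0 // => i; rewrite h => /andP[/eqP ->]; rewrite eqxx.
Qed.

Lemma coclass_degcast m n (e : m = n) (z : cocycles m) (w : cocycles n) :
  (forall s, cocycle_val w s = cocycle_val z (sing_vertex (fun i => inord i) s)) ->
  degcast (A := cohomology) e (coclass z) = coclass w.
Proof.
case: _ / e w => w h; congr coclass; apply: val_inj; apply/funext => s /=.
rewrite h sing_vertex_id // => i; exact: inord_val.
Qed.

Lemma cohom_cupA p q r (x : cohomology p) (y : cohomology q) (z : cohomology r) :
  degcast (A := cohomology) (addnA p q r) (cohom_cup x (cohom_cup y z)) =
  cohom_cup (cohom_cup x y) z.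
Proof.
elim/coclass_ind: x => x; elim/coclass_ind: y => y; elim/coclass_ind: z => z.
rewrite !cohom_cupE; apply: coclass_degcast => s /=.
rewrite /cup !sing_vertex_comp mulrA; congr (cocycle_val x _ * cocycle_val y _ * cocycle_val z _);
  congr (sing_vertex _ s); apply/funext => -[i hi]; apply: val_inj;
  rewrite /= /front /back !inordK /=; lia.
Qed.

Lemma cocycle_unit : (fun=> 1) \in @cocycle 0.
Proof.
apply/cocycleP; apply/funext => s; rewrite /cobnd.
by rewrite !big_ord_recl big_ord0 /= /bump /= expr0 expr1 !mulr1 addr0 subrr.
Qed.

Definition cohom_one : cohomology 0 := coclass (Cocycle cocycle_unit).

Lemma cohom_cup1l p (x : cohomology p) :
  degcast (A := cohomology) (add0n p) (cohom_cup cohom_one x) = x.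
Proof.
elim/coclass_ind: x => x; rewrite cohom_cupE; apply: coclass_degcast => s /=.
rewrite /cup sing_vertex_comp mul1r sing_vertex_id // => i.
apply: val_inj; rewrite /back /=; have := ltn_ord i => hi.
by rewrite !inordK //; lia.
Qed.

Lemma cohom_cup1r p (x : cohomology p) :
  degcast (A := cohomology) (addn0 p) (cohom_cup x cohom_one) = x.
Proof.
elim/coclass_ind: x => x; rewrite cohom_cupE; apply: coclass_degcast => s /=.
rewrite /cup sing_vertex_comp mulr1 sing_vertex_id // => i.
apply: val_inj; rewrite /front /=; have := ltn_ord i => hi.
by rewrite !inordK //; lia.
Qed.

End Space.

Section Pullback.
Variables (X Y : topologicalType) (f : continuousType X Y).

Definition cochain_pull n (phi : cochain Y n) : cochain X n :=
  fun s => phi (sing_push f s).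

Lemma cobnd_pull n (phi : cochain Y n) :
  cobnd (cochain_pull phi) = cochain_pull (cobnd phi).
Proof.
apply/funext => s; apply: eq_bigr => i _.
by rewrite /cochain_pull sing_push_vertex.
Qed.

Lemma cocycle_pull_subproof n (z : cocycles Y n) :
  cochain_pull z \in @cocycle X n.
Proof.
by apply/cocycleP; rewrite cobnd_pull (cocycleP _ (cocycle_valP z)).
Qed.

Definition cocycle_pull n (z : cocycles Y n) : cocycles X n :=
  Cocycle (cocycle_pull_subproof z).

Lemma is_coboundary_pull n (phi : cochain Y n) :
  is_coboundary phi -> is_coboundary (cochain_pull phi).
Proof.
case: n phi => [|n] phi /=; first by move=> ->.
by move=> [psi ->]; exists (cochain_pull psi); rewrite cobnd_pull.
Qed.

Definition cohom_pull n (x : cohomology Y n) : cohomology X n :=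
  coclass (cocycle_pull (corepr x)).

Lemma cohom_pullE n (z : cocycles Y n) :
  cohom_pull (coclass z) = coclass (cocycle_pull z).
Proof.
have /coclass_eqP h := coreprK (coclass z).
exact/coclass_eqP/(is_coboundary_pull h).
Qed.

Lemma cohom_pull_linear n : linear (@cohom_pull n).
Proof.
move=> a; elim/coclass_ind => x; elim/coclass_ind => y.
rewrite -coclassP !cohom_pullE -coclassP; congr coclass.
exact: val_inj.
Qed.

HB.instance Definition _ n :=
  GRing.isLinear.Build K (cohomology Y n) (cohomology X n) *:%R (@cohom_pull n)
    (@cohom_pull_linear n).

Lemma cohom_pull_cup p q (x : cohomology Y p) (y : cohomology Y q) :
  cohom_pull (cohom_cup x y) = cohom_cup (cohom_pull x) (cohom_pull y).
Proof.
elim/coclass_ind: x => x; elim/coclass_ind: y => y.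
rewrite cohom_cupE !cohom_pullE cohom_cupE; congr coclass; apply: val_inj.
by apply/funext => s; rewrite /= /cochain_pull /cup !sing_push_vertex.
Qed.

Lemma cohom_pull1 : cohom_pull (cohom_one Y) = cohom_one X.
Proof. by rewrite cohom_pullE; congr coclass; apply: val_inj. Qed.

End Pullback.

Lemma eq_cohom_pull (X Y : topologicalType) (f g : continuousType X Y) n
  (x : cohomology Y n) : f =1 g -> cohom_pull f x = cohom_pull g x.
Proof. by move=> /continuousEP ->. Qed.

Lemma cohom_pull_id (X : topologicalType) (f : continuousType X X) n
  (x : cohomology X n) : f =1 id -> cohom_pull f x = x.
Proof.
move=> h; elim/coclass_ind: x => x; rewrite cohom_pullE; congr coclass.
apply: val_inj; apply/funext => s /=; rewrite /cochain_pull; congr (cocycle_val x _).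
by apply/continuousEP => v /=; rewrite h.
Qed.

Lemma cohom_pull_comp (X Y Z : topologicalType) (f : continuousType X Y)
    (g : continuousType Y Z) (h : continuousType X Z) n (x : cohomology Z n) :
  h =1 g \o f -> cohom_pull f (cohom_pull g x) = cohom_pull h x.
Proof.
move=> e; elim/coclass_ind: x => x; rewrite !cohom_pullE; congr coclass.
apply: val_inj; apply/funext => s /=; rewrite /cochain_pull; congr (cocycle_val x _).
by apply/continuousEP => v /=; rewrite e.
Qed.

End SingularCohomology.

(* A graded object is given by its homogeneous components. Since p + (q + r)
   and (p + q) + r are only propositionally equal, the associativity and unit
   laws are stated up to transport along equalities of degrees (degcast). *)

Record gradedAlgebra (K : fieldType) := GradedAlgebra {
  galg_deg :> nat -> lmodType K;
  galg_one : galg_deg 0;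
  galg_mul : forall p q, galg_deg p -> galg_deg q -> galg_deg (p + q);
  galg_mul_linearl : forall p q a (x x' : galg_deg p) (y : galg_deg q),
    galg_mul (a *: x + x') y = a *: galg_mul x y + galg_mul x' y;
  galg_mul_linearr : forall p q a (x : galg_deg p) (y y' : galg_deg q),
    galg_mul x (a *: y + y') = a *: galg_mul x y + galg_mul x y';
  galg_mulA : forall p q r (x : galg_deg p) (y : galg_deg q) (z : galg_deg r),
    degcast (addnA p q r) (galg_mul x (galg_mul y z)) =
    galg_mul (galg_mul x y) z;
  galg_mul1l : forall p (x : galg_deg p),
    degcast (add0n p) (galg_mul galg_one x) = x;
  galg_mul1r : forall p (x : galg_deg p),
    degcast (addn0 p) (galg_mul x galg_one) = x
}.

Record gradedModule (K : fieldType) (A : gradedAlgebra K) := GradedModule {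
  gmod_deg :> nat -> lmodType K;
  gmod_act : forall p q, A p -> gmod_deg q -> gmod_deg (p + q);
  gmod_act_linearl : forall p q a (r r' : A p) (x : gmod_deg q),
    gmod_act (a *: r + r') x = a *: gmod_act r x + gmod_act r' x;
  gmod_act_linearr : forall p q a (r : A p) (x x' : gmod_deg q),
    gmod_act r (a *: x + x') = a *: gmod_act r x + gmod_act r x';
  gmod_actA : forall p q n (r : A p) (s : A q) (x : gmod_deg n),
    degcast (addnA p q n) (gmod_act r (gmod_act s x)) =
    gmod_act (galg_mul r s) x;
  gmod_act1 : forall p (x : gmod_deg p),
    degcast (add0n p) (gmod_act (galg_one A) x) = x
}.

Record gradedHom (K : fieldType) (A : gradedAlgebra K) (M N : gradedModule A) :=
  GradedHom {
  ghom_fun :> forall n, M n -> N n;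
  ghom_linear : forall n, linear (@ghom_fun n);
  ghom_act : forall p q (r : A p) (x : M q),
    ghom_fun (gmod_act r x) = gmod_act r (ghom_fun x)
}.

Record persModule (R : realType) (K : fieldType) (A : gradedAlgebra K) :=
  PersModule {
  pmod_obj :> R -> gradedModule A;
  pmod_map : forall s t, s <= t -> gradedHom (pmod_obj t) (pmod_obj s);
  pmod_map_id : forall t (tt : t <= t) n (x : pmod_obj t n),
    pmod_map tt n x = x;
  pmod_map_comp : forall s t u (st : s <= t) (tu : t <= u) (su : s <= u) n
    (x : pmod_obj u n), pmod_map st n (pmod_map tu n x) = pmod_map su n x
}.

Section Interleaving.
Variables (R : realType) (K : fieldType) (A : gradedAlgebra K).
Implicit Types M N : persModule R A.

Definition shift_natural (e : R) M N
    (phi : forall t, gradedHom (N (t + e)) (M t)) : Prop :=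
  forall s t (st : s <= t) (ste : s + e <= t + e) n (x : N (t + e) n),
    phi s n (pmod_map N ste n x) = pmod_map M st n (phi t n x).

Definition interleaved (e : R) M N : Prop :=
  0 <= e /\
  exists (phi : forall t, gradedHom (N (t + e)) (M t))
         (psi : forall t, gradedHom (M (t + e)) (N t)),
  [/\ shift_natural phi, shift_natural psi,
      forall t (le : t <= t + e + e) n (x : M (t + e + e) n),
        phi t n (psi (t + e) n x) = pmod_map M le n x &
      forall t (le : t <= t + e + e) n (x : N (t + e + e) n),
        psi t n (phi (t + e) n x) = pmod_map N le n x].

(* Equal to +oo when M and N are not interleaved for any e. *)
Definition interleaving_distance M N : \bar R :=
  ereal_inf [set e%:E | e in [set e : R | interleaved e M N]].

End Interleaving.

Section RightSpace.
Variables (G : topologicalGroupType) (E : rightGSpace G).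

Definition orbit_rel : rel E := fun x y => `[< exists g, x = ract y g >].

Fact orbit_refl : reflexive orbit_rel.
Proof. by move=> x; apply/asboolP; exists 1%g; rewrite ract1. Qed.

Fact orbit_sym : symmetric orbit_rel.
Proof.
by move=> x y; apply/asboolP/asboolP => -[g ->]; exists g^-1%g;
  rewrite -ractM mulgV ract1.
Qed.

Fact orbit_trans : transitive orbit_rel.
Proof.
move=> y x z /asboolP[g ->] /asboolP[h ->]; apply/asboolP; exists (h * g)%g.
by rewrite ractM.
Qed.

Canonical orbit_equiv := EquivRel orbit_rel orbit_refl orbit_sym orbit_trans.
Canonical orbit_encmod := defaultEncModRel orbit_rel.

Definition orbit_space : topologicalType :=
  quotient_topology {eq_quot orbit_rel}.

Definition orbit_proj (x : E) : orbit_space := \pi_({eq_quot orbit_rel}) x.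

Lemma orbit_proj_continuous : continuous orbit_proj.
Proof. exact: pi_continuous. Qed.

(* phi and psi are mutually inverse G-equivariant homeomorphisms over U
   between U x G and the preimage of U. *)
Definition local_trivialization (U : set orbit_space)
    (phi : orbit_space * G -> E) (psi : E -> orbit_space * G) : Prop :=
  [/\ {within U `*` setT, continuous phi},
      {within orbit_proj @^-1` U, continuous psi},
      forall b g, U b -> orbit_proj (phi (b, g)) = b /\ psi (phi (b, g)) = (b, g),
      forall x, U (orbit_proj x) -> phi (psi x) = x &
      forall b g h, U b -> phi (b, (g * h)%g) = ract (phi (b, g)) h].

Definition principal_bundle : Prop :=
  forall b : orbit_space, exists (U : set orbit_space) phi psi,
    [/\ open U, U b & local_trivialization U phi psi].

End RightSpace.

Definition contractible (R : realType) (T : topologicalType) : Prop :=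
  exists (t0 : T) (H : R * T -> T),
    [/\ {within `[0%R, 1%R] `*` setT, continuous H},
        forall t, H (0, t) = t & forall t, H (1, t) = t0].

(* E -> E / G is a model of EG -> BG. Any model may be used: no particular
   construction of EG (such as the infinite join) is singled out, and the
   trivializing cover is not required to be numerable. *)
Definition universal_bundle (R : realType) (G : topologicalGroupType)
    (E : rightGSpace G) : Prop := principal_bundle E /\ contractible R E.

Section Borel.
Variables (G : topologicalGroupType) (E : rightGSpace G).

Section BorelSpace.
Variable Y : gSpace G.

(* (e g, y) ~ (e, g y) *)
Definition borel_rel : rel (E * Y) := fun p q =>
  `[< exists g, p.1 = ract q.1 g /\ q.2 = lact g p.2 >].

Fact borel_refl : reflexive borel_rel.
Proof. by move=> x; apply/asboolP; exists 1%g; rewrite ract1 lact1. Qed.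

Fact borel_sym : symmetric borel_rel.
Proof.
have h p q : borel_rel p q -> borel_rel q p.
  move=> /asboolP[g [h1 h2]]; apply/asboolP; exists g^-1%g.
  by rewrite h1 h2 -ractM -lactM mulgV mulVg ract1 lact1.
by move=> p q; apply/idP/idP; apply: h.
Qed.

Fact borel_trans : transitive borel_rel.
Proof.
move=> q p r /asboolP[g [h1 h2]] /asboolP[h [h3 h4]]; apply/asboolP.
by exists (h * g)%g; rewrite h1 h3 h4 h2 ractM lactM.
Qed.

Canonical borel_equiv := EquivRel borel_rel borel_refl borel_sym borel_trans.
Canonical borel_encmod := defaultEncModRel borel_rel.

Definition borel : topologicalType := quotient_topology {eq_quot borel_rel}.

Definition borel_pi (p : E * Y) : borel := \pi_({eq_quot borel_rel}) p.

Definition borel_repr (z : borel) : E * Y := repr (z : {eq_quot borel_rel}).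

Lemma borel_reprK z : borel_pi (borel_repr z) = z.
Proof. exact: reprK. Qed.

Lemma borel_piP p q :
  borel_pi p = borel_pi q <-> exists g, p.1 = ract q.1 g /\ q.2 = lact g p.2.
Proof.
by split=> [/eqmodP/asboolP|h] //; apply/eqmodP/asboolP.
Qed.

Lemma borel_continuous (T : topologicalType) (h : borel -> T) :
  continuous (h \o borel_pi) -> continuous h.
Proof. by move=> /(@quotient_continuous _ _ T h). Qed.

Definition borel_base (z : borel) : orbit_space E :=
  orbit_proj (borel_repr z).1.

Lemma borel_baseE p : borel_base (borel_pi p) = orbit_proj p.1.
Proof.
have /borel_piP[g [h _]] := borel_reprK (borel_pi p).
by apply/eqmodP/asboolP; exists g.
Qed.

Lemma borel_base_continuous : continuous borel_base.
Proof.
apply: borel_continuous; rewrite (_ : _ \o _ = @orbit_proj G E \o fst).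
  move=> p; apply: continuous_comp; first exact: cvg_fst.
  exact: orbit_proj_continuous.
by apply/funext => p /=; rewrite borel_baseE.
Qed.

End BorelSpace.

Section BorelMap.
Variables (Y Z : gSpace G) (f : gMap Y Z).

Definition borel_map (z : borel Y) : borel Z :=
  borel_pi ((borel_repr z).1, f (borel_repr z).2).

Lemma borel_mapE p : borel_map (borel_pi p) = borel_pi (p.1, f p.2).
Proof.
have /borel_piP[g [h1 h2]] := borel_reprK (borel_pi p).
by apply/borel_piP; exists g; rewrite /= h2 gmapE.
Qed.

Lemma borel_map_continuous : continuous borel_map.
Proof.
apply: borel_continuous.
rewrite (_ : _ \o _ = @borel_pi Z \o (fun p => (p.1, f p.2))).
  move=> p; apply: continuous_comp; last exact: pi_continuous.
  apply: cvg_pair => /=; first exact: cvg_fst.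
  by apply: continuous_comp; [exact: cvg_snd|exact: gmap_continuous].
by apply/funext => p /=; rewrite borel_mapE.
Qed.

Lemma borel_base_map z : borel_base (borel_map z) = borel_base z.
Proof. by rewrite -[z]borel_reprK borel_mapE !borel_baseE. Qed.

End BorelMap.
End Borel.

Section EquivariantCohomology.
Variables (R : realType) (K : fieldType) (G : topologicalGroupType).
Variable E : rightGSpace G.

Definition cohomology_algebra (X : topologicalType) : gradedAlgebra K :=
  @GradedAlgebra K (cohomology R K X) (cohom_one R K X) (@cohom_cup R K X)
    (@cohom_cup_linearl R K X) (@cohom_cup_linearr R K X)
    (@cohom_cupA R K X) (@cohom_cup1l R K X) (@cohom_cup1r R K X).

Definition HBG : gradedAlgebra K := cohomology_algebra (orbit_space E).

Section Module.
Variable Y : gSpace G.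

Definition borel_basec : continuousType (borel E Y) (orbit_space E) :=
  mkcts (@borel_base_continuous G E Y).

Definition HG_act p q (r : HBG p) (x : cohomology R K (borel E Y) q) :
  cohomology R K (borel E Y) (p + q) := cohom_cup (cohom_pull borel_basec r) x.

Fact HG_act_linearl p q a (r r' : HBG p) (x : cohomology R K (borel E Y) q) :
  HG_act (a *: r + r') x = a *: HG_act r x + HG_act r' x.
Proof. by rewrite /HG_act linearP cohom_cup_linearl. Qed.

Fact HG_act_linearr p q a (r : HBG p) (x x' : cohomology R K (borel E Y) q) :
  HG_act r (a *: x + x') = a *: HG_act r x + HG_act r x'.
Proof. exact: cohom_cup_linearr. Qed.

Fact HG_actA p q n (r : HBG p) (s : HBG q) (x : cohomology R K (borel E Y) n) :
  degcast (A := cohomology R K (borel E Y)) (addnA p q n)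
    (HG_act r (HG_act s x)) = HG_act (galg_mul r s) x.
Proof. by rewrite /HG_act cohom_cupA cohom_pull_cup. Qed.

Fact HG_act1 p (x : cohomology R K (borel E Y) p) :
  degcast (A := cohomology R K (borel E Y)) (add0n p)
    (HG_act (galg_one HBG) x) = x.
Proof. by rewrite /HG_act cohom_pull1 cohom_cup1l. Qed.

Definition HG : gradedModule HBG :=
  @GradedModule K HBG (cohomology R K (borel E Y)) HG_act
    HG_act_linearl HG_act_linearr HG_actA HG_act1.

End Module.

Section Map.
Variables (Y Z : gSpace G) (f : gMap Y Z).

Definition borel_mapc : continuousType (borel E Y) (borel E Z) :=
  mkcts (@borel_map_continuous G E Y Z f).

Definition HG_map_fun n (x : HG Z n) : HG Y n := cohom_pull borel_mapc x.

Fact HG_map_linear n : linear (@HG_map_fun n).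
Proof. exact: cohom_pull_linear. Qed.

Fact HG_map_act p q (r : HBG p) (x : HG Z q) :
  HG_map_fun (gmod_act r x) = gmod_act r (HG_map_fun x).
Proof.
rewrite /HG_map_fun /= /HG_act cohom_pull_cup; congr cohom_cup.
by apply: cohom_pull_comp => z /=; rewrite /mkcts borel_base_map.
Qed.

Definition HG_map : gradedHom (HG Z) (HG Y) :=
  @GradedHom K HBG (HG Z) (HG Y) HG_map_fun HG_map_linear HG_map_act.

End Map.

Lemma HG_map_id (Y : gSpace G) (f : gMap Y Y) n (x : HG Y n) :
  f =1 id -> HG_map f n x = x.
Proof.
move=> h; apply: cohom_pull_id => z /=.
by rewrite /mkcts -[z]borel_reprK borel_mapE h -surjective_pairing.
Qed.

Lemma HG_map_comp (X Y Z : gSpace G) (f : gMap X Y) (g : gMap Y Z)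
    (h : gMap X Z) n (x : HG Z n) :
  h =1 g \o f -> HG_map f n (HG_map g n x) = HG_map h n x.
Proof.
move=> e; apply: cohom_pull_comp => z /=.
by rewrite /mkcts -[z]borel_reprK !borel_mapE e.
Qed.

End EquivariantCohomology.

Record persGSpace (R : realType) (G : topologicalGroupType) := PersGSpace {
  pgsp_obj :> R -> gSpace G;
  pgsp_map : forall s t, s <= t -> gMap (pgsp_obj s) (pgsp_obj t);
  pgsp_map_id : forall t (tt : t <= t) x, pgsp_map tt x = x;
  pgsp_map_comp : forall s t u (st : s <= t) (tu : t <= u) (su : s <= u) x,
    pgsp_map su x = pgsp_map tu (pgsp_map st x)
}.

Section PersistentCohomology.
Variables (R : realType) (K : fieldType) (G : topologicalGroupType).
Variables (E : rightGSpace G) (P : persGSpace R G).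

Fact HG_pers_id t (tt : t <= t) n (x : HG R K E (P t) n) :
  HG_map R K E (pgsp_map P tt) n x = x.
Proof. by apply: HG_map_id => y; rewrite pgsp_map_id. Qed.

Fact HG_pers_comp s t u (st : s <= t) (tu : t <= u) (su : s <= u) n
    (x : HG R K E (P u) n) :
  HG_map R K E (pgsp_map P st) n (HG_map R K E (pgsp_map P tu) n x) =
  HG_map R K E (pgsp_map P su) n x.
Proof. by apply: HG_map_comp => y /=; rewrite (pgsp_map_comp st tu). Qed.

Definition HG_pers : persModule R (HBG R K E) :=
  @PersModule R K (HBG R K E) (fun t => HG R K E (P t))
    (fun s t st => HG_map R K E (pgsp_map P st)) HG_pers_id HG_pers_comp.

End PersistentCohomology.

Definition g_invariant (R : realType) (G : topologicalGroupType) (X : gSpace G)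
    (f : X -> R) : Prop := forall g x, f (lact g x) = f x.

Section Sublevel.
Variables (R : realType) (G : topologicalGroupType) (X : gSpace G).
Variables (f : X -> R) (f_inv : g_invariant f).

Definition sublevel (t : R) : set X := [set x | f x <= t].

Section Level.
Variable t : R.

Fact sublevel_act_subproof g (x : sublevel t) :
  lact g (\val x) \in sublevel t.
Proof. by have := valP x; rewrite !inE /sublevel /= f_inv. Qed.

Definition sublevel_act (g : G) (x : sublevel t) : sublevel t :=
  exist _ (lact g (\val x)) (sublevel_act_subproof g x).

Fact sublevel_act1 x : sublevel_act 1%g x = x.
Proof. by apply: val_inj; rewrite /= lact1. Qed.

Fact sublevel_actM g h x :
  sublevel_act (g * h)%g x = sublevel_act g (sublevel_act h x).
Proof. by apply: val_inj; rewrite /= lactM. Qed.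

Fact sublevel_act_continuous :
  continuous (fun p : G * sublevel t => sublevel_act p.1 p.2).
Proof.
apply: into_set_type_continuous => /= p.
apply: (@continuous_comp _ _ _ (fun p : G * sublevel t => (p.1, \val p.2))
  (fun q : G * X => lact q.1 q.2)); last exact: lact_continuous.
apply: cvg_pair; first exact: cvg_fst.
by apply: continuous_comp; [exact: cvg_snd|exact: initial_continuous].
Qed.

Definition sublevel_gSpace : gSpace G :=
  @GSpace G (sublevel t) sublevel_act sublevel_act1 sublevel_actM
    sublevel_act_continuous.

End Level.

Section Inclusion.
Variables (s t : R) (st : s <= t).

Fact sublevel_incl_subproof (x : sublevel s) : \val x \in sublevel t.
Proof. by have := valP x; rewrite !inE /sublevel /= => /le_trans; apply. Qed.

Definition sublevel_incl_fun (x : sublevel_gSpace s) : sublevel_gSpace t :=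
  exist _ (\val (x : sublevel s)) (sublevel_incl_subproof x).

Fact sublevel_incl_continuous : continuous sublevel_incl_fun.
Proof.
apply: into_set_type_continuous => /=; exact: initial_continuous.
Qed.

Fact sublevel_inclE g x :
  sublevel_incl_fun (lact g x) = lact g (sublevel_incl_fun x).
Proof. exact: val_inj. Qed.

Definition sublevel_incl : gMap (sublevel_gSpace s) (sublevel_gSpace t) :=
  GMap sublevel_incl_continuous sublevel_inclE.

End Inclusion.

Fact sublevel_incl_id t (tt : t <= t) x : sublevel_incl tt x = x.
Proof. exact: val_inj. Qed.

Fact sublevel_incl_comp s t u (st : s <= t) (tu : t <= u) (su : s <= u) x :
  sublevel_incl su x = sublevel_incl tu (sublevel_incl st x).
Proof. exact: val_inj. Qed.

Definition sublevel_pers : persGSpace R G :=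
  @PersGSpace R G sublevel_gSpace sublevel_incl sublevel_incl_id
    sublevel_incl_comp.

End Sublevel.

(* 0 is adjoined so that the supremum over an empty X is 0 and not -oo. *)
Definition sup_dist (R : realType) (X : Type) (f g : X -> R) : \bar R :=
  ereal_sup (0%E |` range (fun x => `|f x - g x|%:E)).

(* Main.v *)
Require Import Defs.
From mathcomp Require Import all_boot all_order all_algebra.
From mathcomp Require Import all_classical all_reals all_analysis.

(** Write [eps] for a real bound on the uniform distance from [f] to [g].  A
    point with [f x <= t] satisfies [g x <= t + eps], so the identity of [X]
    restricts to an equivariant inclusion of the [t]-sublevel of [f] into the
    [t + eps]-sublevel of [g], and vice versa ([sublevel_map]).  Every diagram
    made of these inclusions and of the structure inclusions of the two
    filtrations commutes, because all of its arrows are the identity on the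
    underlying points of [X].  Equivariant cohomology is a contravariant
    functor, so it turns these diagrams into the naturality squares
    ([HG_shift_natural]) and the triangles ([HG_shift_comp]) of an
    [eps]-interleaving.

    The bound on the interleaving distance follows: a finite uniform distance
    is itself one of the [eps] over which the infimum is taken, and an
    infinite one bounds everything. *)

Import Order.TTheory GRing.Theory Num.Theory.
Local Open Scope ring_scope.

Lemma sublevel_map_subproof {R : realType} {G : topologicalGroupType}
    {X : gSpace G} {f g : X -> R} {s t : R} (st : forall x, f x <= s -> g x <= t) (x : sublevel f s) :
  \val x \in sublevel g t.
Proof. by have := valP x; rewrite !inE; apply: st. Qed.

Definition sublevel_map_fun {R : realType} {G : topologicalGroupType}
    {X : gSpace G} {f g : X -> R} (f_inv : g_invariant f)
    (g_inv : g_invariant g) {s t : R} (st : forall x, f x <= s -> g x <= t)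
    (x : sublevel_gSpace f_inv s) : sublevel_gSpace g_inv t :=
  exist _ (\val (x : sublevel f s)) (sublevel_map_subproof st x).

Lemma sublevel_map_continuous {R : realType} {G : topologicalGroupType}
    {X : gSpace G} {f g : X -> R} (f_inv : g_invariant f)
    (g_inv : g_invariant g) {s t : R} (st : forall x, f x <= s -> g x <= t) :
  continuous (sublevel_map_fun f_inv g_inv st).
Proof. by apply: into_set_type_continuous; exact: initial_continuous. Qed.

Lemma sublevel_map_act {R : realType} {G : topologicalGroupType}
    {X : gSpace G} {f g : X -> R} (f_inv : g_invariant f)
    (g_inv : g_invariant g) {s t : R} (st : forall x, f x <= s -> g x <= t)
    (a : G) (x : sublevel_gSpace f_inv s) :
  sublevel_map_fun f_inv g_inv st (lact a x) =
  lact a (sublevel_map_fun f_inv g_inv st x).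
Proof. exact: val_inj. Qed.

(** The two functions and the two levels are independent of each other, so
    that the interleaving maps in both directions and the diagonals of the
    naturality squares are all instances. *)
Definition sublevel_map {R : realType} {G : topologicalGroupType}
    {X : gSpace G} {f g : X -> R} (f_inv : g_invariant f)
    (g_inv : g_invariant g) {s t : R} (st : forall x, f x <= s -> g x <= t) :
  gMap (sublevel_gSpace f_inv s) (sublevel_gSpace g_inv t) :=
  GMap (sublevel_map_continuous f_inv g_inv st)
    (sublevel_map_act f_inv g_inv st).

Lemma sublevel_shift_le {R : realDomainType} {T : Type} {f g : T -> R} {e : R}
    (gf : forall x, g x <= f x + e) (t : R) (x : T) :
  f x <= t -> g x <= t + e.
Proof. by move=> fxt; apply: le_trans (gf x) _; rewrite lerD2r. Qed.

(** Only one half of a uniform bound is assumed; the two halves give the two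
    directions of the interleaving. *)
Definition HG_shift {R : realType} (K : fieldType) {G : topologicalGroupType}
    (E : rightGSpace G) {X : gSpace G} {f g : X -> R} (f_inv : g_invariant f)
    (g_inv : g_invariant g) {e : R} (gf : forall x, g x <= f x + e) (t : R) :
  gradedHom (HG_pers K E (sublevel_pers g_inv) (t + e))
    (HG_pers K E (sublevel_pers f_inv) t) :=
  HG_map R K E (sublevel_map f_inv g_inv (sublevel_shift_le gf t)).

(** Both sides are the pullback along one inclusion, the diagonal of the
    square: that of the [s]-sublevel of [f] into the [t + e]-sublevel of
    [g]. *)
Lemma HG_shift_natural {R : realType} (K : fieldType)
    {G : topologicalGroupType} (E : rightGSpace G) {X : gSpace G}
    {f g : X -> R} (f_inv : g_invariant f) (g_inv : g_invariant g) {e : R}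
    (gf : forall x, g x <= f x + e) :
  shift_natural (HG_shift K E f_inv g_inv gf).
Proof.
move=> s t st ste n x /=.
have diag y : f y <= s -> g y <= t + e.
  by move=> fys; apply: sublevel_shift_le gf t y (le_trans fys st).
transitivity (HG_map R K E (sublevel_map f_inv g_inv diag) n x).
  by apply: HG_map_comp => y; apply: val_inj.
by symmetry; apply: HG_map_comp => y; apply: val_inj.
Qed.

Lemma HG_shift_comp {R : realType} (K : fieldType) {G : topologicalGroupType}
    (E : rightGSpace G) {X : gSpace G} {f g : X -> R} (f_inv : g_invariant f)
    (g_inv : g_invariant g) {e : R} (gf : forall x, g x <= f x + e)
    (fg : forall x, f x <= g x + e) (t : R) (le : t <= t + e + e) (n : nat)
    (x : HG_pers K E (sublevel_pers f_inv) (t + e + e) n) :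
  HG_shift K E f_inv g_inv gf t n (HG_shift K E g_inv f_inv fg (t + e) n x) =
  pmod_map (HG_pers K E (sublevel_pers f_inv)) le n x.
Proof. by apply: HG_map_comp => y; apply: val_inj. Qed.

Lemma HG_sublevel_interleaved {R : realType} (K : fieldType)
    {G : topologicalGroupType} (E : rightGSpace G) {X : gSpace G}
    {f g : X -> R} (f_inv : g_invariant f) (g_inv : g_invariant g) {e : R}
    (e_ge0 : 0 <= e) (gf : forall x, g x <= f x + e)
    (fg : forall x, f x <= g x + e) :
  interleaved e (HG_pers K E (sublevel_pers f_inv))
    (HG_pers K E (sublevel_pers g_inv)).
Proof.
split=> //; exists (HG_shift K E f_inv g_inv gf), (HG_shift K E g_inv f_inv fg).
by split; [exact: HG_shift_natural|exact: HG_shift_natural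
  |exact: HG_shift_comp|exact: HG_shift_comp].
Qed.

Lemma sup_dist_ge0 {R : realType} {T : Type} (f g : T -> R) :
  (0 <= sup_dist f g)%E.
Proof. by apply: ereal_sup_ubound; left. Qed.

Lemma le_sup_dist {R : realType} {T : Type} (f g : T -> R) (x : T) :
  (`|f x - g x|%:E <= sup_dist f g)%E.
Proof. by apply: ereal_sup_ubound; right; exists x. Qed.

Theorem theorem3p3p6 (R : realType) (K : fieldType) (G : topologicalGroupType)
    (hausG : hausdorff_space G)
    (EG : rightGSpace G) (univ_EG : universal_bundle R EG)
    (X : gSpace G) (f g : X -> R)
    (f_inv : g_invariant f) (g_inv : g_invariant g) :
  (interleaving_distance (HG_pers K EG (sublevel_pers f_inv))
     (HG_pers K EG (sublevel_pers g_inv)) <= sup_dist f g)%E /\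
  (forall eps : R, (sup_dist f g <= eps%:E)%E ->
     interleaved eps (HG_pers K EG (sublevel_pers f_inv))
       (HG_pers K EG (sublevel_pers g_inv))).
Proof.
have interl eps : (sup_dist f g <= eps%:E)%E ->
    interleaved eps (HG_pers K EG (sublevel_pers f_inv))
      (HG_pers K EG (sublevel_pers g_inv)).
  move=> fg_le; have dist x : `|f x - g x| <= eps.
    by rewrite -lee_fin (le_trans (le_sup_dist f g x)).
  apply: HG_sublevel_interleaved => [|x|x].
  - by rewrite -lee_fin (le_trans (sup_dist_ge0 f g)).
  - by move: (dist x); rewrite ler_distlC lerBlDr => /andP[].
  - by move: (dist x); rewrite ler_distl => /andP[].
split=> //.
have := sup_dist_ge0 f g.
case dE : (sup_dist f g) => [d| |] // _; last by rewrite leey.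
by apply: ereal_inf_lbound; exists d => //; apply: interl; rewrite dE.
Qed.
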